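(* Let $(X,d)$ be a metric space with nice closed balls. If $(CL(X),\tau_{w(d)})$ is non-normal, then $(CL(X),\tau_{w(d)})$ contains a closed copy of $\omega_1 \times (\omega_1 + 1)$, i.e. a closed subspace homeomorphic to $\omega_1 \times (\omega_1+1)$.
   Context: $CL(X)$ denotes the family of all nonempty closed subsets of $X$. For $x \in X$ and nonempty $A \subseteq X$, $d(x,A) = \inf\{d(x,a): a \in A\}$. The Wijsman topology $\tau_{w(d)}$ on $CL(X)$ is the weakest topology for which, for every $x \in X$, the distance functional $A \mapsto d(x,A)$ from $CL(X)$ to $[0,\infty)$ is continuous. A metric space $(X,d)$ has nice closed balls if every closed ball in $X$ that is a proper subset of $X$ is compact. The ordinals $\omega_1$ (the first uncountable ordinal) and $\omega_1+1$ carry their order topologies, and $\omega_1\times(\omega_1+1)$ carries the product topology. *)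

(* Defs.v *)
From HB Require Import structures.
From mathcomp Require Import all_boot all_order all_algebra.
From mathcomp Require Import all_classical all_reals all_analysis.
From mathcomp Require Import wochoice.

Set Implicit Arguments.
Unset Strict Implicit.
Unset Printing Implicit Defensive.

Import Order.TTheory GRing.Theory Num.Theory numFieldNormedType.Exports.

Local Open Scope classical_set_scope.
Local Open Scope ring_scope.

Section Hyperspace.
Context {R : realType} (X : metricType R).

Definition CL : set (set X) := [set A | A !=set0 /\ closed A].

Definition dist_to (x : X) (A : set X) : R := inf [set mdist x a | a in A].

Definition wijsman : topologicalType :=
  sup_topology (fun x : X =>
    Topological.on (initial_topology (fun A : CL => dist_to x (set_val A)))).

(* The library's [closed_ball] is the closure of the open ball, which can be
   smaller than the set below in a general metric space. *)
Definition mclosed_ball (x : X) (r : R) : set X := [set y | mdist x y <= r].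

Definition nice_closed_balls : Prop :=
  forall (x : X) (r : R), 0 < r ->
    mclosed_ball x r != setT -> compact (mclosed_ball x r).

End Hyperspace.

Arguments CL {R} X.

Definition homeomorphic (S T : topologicalType) : Prop :=
  exists (f : S -> T) (g : T -> S),
    [/\ cancel f g, cancel g f, continuous f & continuous g].

(* Fix a well-order on the uncountable type [set nat].  The points with
   countably many predecessors form an initial segment of order type omega_1:
   see [omega1_well_order], [omega1_countable_lt] and [omega1_uncountable],
   which determine it up to order isomorphism. *)
Definition wo_set_nat : Type := set nat.

HB.instance Definition _ := Choice.copy wo_set_nat (set nat).

Definition wo_le : rel wo_set_nat :=
  sval (well_ordering_principle wo_set_nat).

Lemma wo_leP : well_order wo_le.
Proof. exact: svalP (well_ordering_principle wo_set_nat). Qed.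

Lemma wo_le_chain : wo_chain wo_le predT.
Proof. by move=> A _; exact: wo_leP. Qed.

Lemma wo_le_refl : reflexive wo_le.
Proof. by move=> x; exact: (wo_chain_reflexive wo_le_chain). Qed.

Lemma wo_le_anti : antisymmetric wo_le.
Proof. by move=> x y; exact: (wo_chain_antisymmetric wo_le_chain). Qed.

Lemma wo_le_total : total wo_le.
Proof. by move=> x y; exact: (wo_chainW wo_le_chain). Qed.

Lemma wo_le_trans : transitive wo_le.
Proof.
move=> y x z xy yz.
have [|m [[mA mlb] _]] := wo_leP (A := [pred t | [|| t == x, t == y | t == z]]).
  by exists x; rewrite inE eqxx.
have mx : wo_le m x by apply: mlb; rewrite !inE eqxx.
have my : wo_le m y by apply: mlb; rewrite !inE eqxx orbT.
have mz : wo_le m z by apply: mlb; rewrite !inE eqxx !orbT.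
move: mA; rewrite !inE => /or3P[] /eqP mE; subst m => //.
- by have -> : x = y by apply: wo_le_anti; rewrite xy mx.
- have zy : z = y by apply: wo_le_anti; rewrite my yz.
  by rewrite zy.
Qed.

Fact wo_display : Order.disp_t. Proof. exact: Order.Disp tt tt. Qed.

HB.instance Definition _ := Order.Le_isPOrder.Build wo_display wo_set_nat
  wo_le_refl wo_le_anti wo_le_trans.
HB.instance Definition _ := Order.POrder_isTotal.Build wo_display wo_set_nat
  wo_le_total.

Definition omega1 : Type :=
  {x : wo_set_nat | `[< countable [set y | (y < x)%O] >]}.

HB.instance Definition _ := SubChoice.on omega1.

Fact omega1_display : Order.disp_t. Proof. exact: Order.Disp tt tt. Qed.

HB.instance Definition _ :=
  [SubChoice_isSubOrder of omega1 by <: with omega1_display].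

Lemma wo_set_nat_min (A : set wo_set_nat) : A !=set0 ->
  exists2 m, A m & forall a, A a -> (m <= a)%O.
Proof.
move=> [a Aa].
have [|m [[mA mlb] _]] := wo_leP (A := [pred t | `[< A t >]]).
  by exists a; apply/asboolP.
exists m; first exact/asboolP.
by move=> b Ab; apply: mlb; apply/asboolP.
Qed.

Lemma omega1_well_order : well_order (fun x y : omega1 => (x <= y)%O).
Proof.
apply: antisymmetric_well_order; first by move=> x y /le_anti.
move=> A [a Aa].
have [|_ [m mA <-] mlb] := @wo_set_nat_min [set \val x | x in [set x | x \in A]].
  by exists (\val a), a.
exists m; split => // b Ab.
by rewrite -(Order.le_val); apply: mlb; exists b.
Qed.

Lemma omega1_countable_lt (x : omega1) : countable [set y | (y < x)%O].
Proof.
have /asboolP/countable_injP[f finj] := valP x.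
apply/countable_injP; exists (f \o \val) => y z /set_mem yx /set_mem zx /= fyz.
by apply/val_inj/finj; rewrite ?inE //= lt_val; assumption.
Qed.

Lemma wo_set_nat_uncountable : ~ countable [set: wo_set_nat].
Proof.
move/countable_injP => [f finj].
pose D : set nat := [set n | exists2 A : wo_set_nat, f A = n & ~ A n].
have [nDf|] := pselect (D (f D)); last first.
  by move=> nD; apply: (nD); exists D.
case: (nDf) => A fA; rewrite (finj A D)// ?inE//.
Qed.

Lemma omega1_uncountable : ~ countable [set: omega1].
Proof.
move=> /countable_injP[f finj].
pose I := [set x : wo_set_nat | countable [set y | (y < x)%O]].
have Ic : countable I.
  apply/countable_injP.
  exists (fun x => if insub x is Some u then f u else 0%N) => x y.
  move=> /set_mem/asboolT Ix /set_mem/asboolT Iy.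
  rewrite !insubT => /finj xy; have := xy (in_setT _) (in_setT _).
  by move=> /(congr1 val).
have [IT|] := pselect (I = setT).
  by apply: wo_set_nat_uncountable; rewrite -IT.
rewrite -subTset => /existsNP[x /not_implyP[_ nIx]].
have [|m nIm mlb] := @wo_set_nat_min (~` I); first by exists x.
apply: nIm; apply: sub_countable Ic; apply: subset_card_le => y /= ym.
by apply: contrapT => /mlb; rewrite leNgt ym.
Qed.

(* [osucc T] is the order [T] with one new top element, [None]. *)
Definition osucc (T : Type) : Type := option T.

HB.instance Definition _ (T : choiceType) := Choice.copy (osucc T) (option T).

Section Osucc.
Context {d : Order.disp_t} {T : orderType d}.

Definition osucc_le (x y : osucc T) : bool :=
  match x, y with
  | _, None => true
  | None, Some _ => false
  | Some a, Some b => (a <= b)%O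
  end.

Lemma osucc_le_refl : reflexive osucc_le.
Proof. by case=> /=. Qed.

Lemma osucc_le_anti : antisymmetric osucc_le.
Proof. by case=> [a|] [b|] //= /le_anti ->. Qed.

Lemma osucc_le_trans : transitive osucc_le.
Proof. by case=> [a|] [b|] [c|] //=; exact: le_trans. Qed.

Lemma osucc_le_total : total osucc_le.
Proof. by case=> [a|] [b|] //=; exact: le_total. Qed.

HB.instance Definition _ := Order.Le_isPOrder.Build d (osucc T)
  osucc_le_refl osucc_le_anti osucc_le_trans.
HB.instance Definition _ := Order.POrder_isTotal.Build d (osucc T)
  osucc_le_total.

End Osucc.

(* Main.v *)
Require Import Defs.
From mathcomp Require Import all_boot all_order all_algebra.
From mathcomp Require Import all_classical all_reals all_analysis.
From mathcomp Require Import finmap wochoice lra.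

(** If [X] is separable, countably many distance functionals generate the
    Wijsman topology, which is then pseudometrizable, hence normal.  So let [X]
    be non-separable, and let [ecc x] be the supremum of [d(x, y)] over [y].
    Every closed ball around [x] of radius less than [ecc x] is proper, hence
    compact, so the points at distance less than [ecc x] from [x] form a
    separable set.  Consequently any countably many points [c] admit a common
    [z] with [d(c, z) = ecc c] for all [c].  It follows that [ecc] attains a
    maximum [rho], and a transfinite recursion along
    [omega1 * (omega1 + 1)], well-ordered with countable initial segments,
    yields points [s i], indexed by that set, at mutual distance [rho].  The
    embedding maps [p] to the set of all [s q] with [p <= q] in the product
    order.  It is continuous because any ball around [x] of radius less than
    [ecc x] contains only finitely many of the [s i].  Its image is closed: a
    set in the closure consists of points [s i], and testing membership for
    three indices at a time shows that it is the image of the pair of minima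
    of the coordinates of these indices. *)

Import Order.TTheory GRing.Theory Num.Theory numFieldNormedType.Exports.

Set Implicit Arguments.
Unset Strict Implicit.
Unset Printing Implicit Defensive.

Local Open Scope classical_set_scope.

(** * Distance functionals *)

Section DistTo.
Local Open Scope ring_scope.
Context {R : realType} {X : metricType R}.
Implicit Types (x y : X) (A B : set X).

Lemma dist_to_le x A a : A a -> dist_to x A <= mdist x a.
Proof.
move=> Aa; apply: ge_inf; last by exists a.
by exists 0 => _ [b _ <-]; exact: mdist_ge0.
Qed.

Lemma le_dist_to x A m : A !=set0 -> (forall a, A a -> m <= mdist x a) ->
  m <= dist_to x A.
Proof.
move=> [a Aa] mA; apply: lb_le_inf; first by exists (mdist x a), a.
by move=> _ [b Ab <-]; exact: mA.
Qed.

Lemma dist_to_lt x A e : A !=set0 -> dist_to x A < e ->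
  exists2 a, A a & mdist x a < e.
Proof.
move=> A0 xAe; apply: contrapT => nA; move: xAe; apply/negP; rewrite -leNgt.
apply: le_dist_to => // a Aa; rewrite leNgt; apply/negP => xa.
by apply: nA; exists a.
Qed.

Lemma dist_to_ge0 x A : A !=set0 -> 0 <= dist_to x A.
Proof. by move=> A0; apply: le_dist_to => // a _; exact: mdist_ge0. Qed.

Lemma dist_to_mem x A : A x -> dist_to x A = 0.
Proof.
move=> Ax; apply/eqP; rewrite eq_le dist_to_ge0 ?andbT; last by exists x.
by rewrite -(mdistxx x) dist_to_le.
Qed.

Lemma dist_to_triangle x y A : A !=set0 ->
  dist_to x A <= mdist x y + dist_to y A.
Proof.
move=> A0; rewrite -lerBlDl; apply: le_dist_to => // a Aa.
by rewrite lerBlDl (le_trans (dist_to_le _ Aa))// metric_triangle.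
Qed.

Lemma dist_to_gt0 x A : closed A -> A !=set0 -> ~ A x -> 0 < dist_to x A.
Proof.
move=> cA A0 nAx; rewrite lt_neqAle dist_to_ge0// andbT eq_sym.
apply/negP => /eqP d0; apply: nAx; apply: cA => U.
rewrite -nbhs_ballE => -[e /= e0 xeU].
have [|a Aa xa] := @dist_to_lt x A e A0; first by rewrite d0.
by exists a; split => //; apply: xeU; rewrite ballEmdist.
Qed.

Lemma wijsman_dist_to_continuous x :
  continuous (fun A : wijsman X => dist_to x (set_val A)).
Proof.
move=> A; have cA : nbhs A --> A by exact: cvg_id.
have /cvg_sup/(_ x) {}cA := cA.
apply: cvg_trans (@initial_continuous _ _ _ A) => //=; exact: cvg_app cA.
Qed.

Lemma continuous_to_wijsman (T : topologicalType) (f : T -> wijsman X) :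
  (forall x, continuous (fun t => dist_to x (set_val (f t)))) -> continuous f.
Proof.
move=> cf t; apply/cvg_sup => x.
exact: (@continuous_comp_initial _ _ _
  (fun A : CL X => dist_to x (set_val A)) f (cf x) t).
Qed.

End DistTo.

(** * Separability and total boundedness of compact sets *)

Section Separable.
Local Open Scope ring_scope.
Context {R : realType} {X : metricType R}.
Implicit Types (x y : X) (A B : set X).

(** The approximating set [C] may leave [A], which lets the notion pass to subsets directly. *)
Definition separable A := exists2 C : set X, countable C &
  forall a e, A a -> 0 < e -> exists2 c, C c & mdist a c < e.

Lemma separable_sub A B : A `<=` B -> separable B -> separable A.
Proof.
by move=> AB [C cC CB]; exists C => // a e Aa; apply: CB; exact: AB.
Qed.

Lemma separable_countable A : countable A -> separable A.
Proof. by move=> cA; exists A => // a e Aa e0; exists a; rewrite ?mdistxx. Qed.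

Lemma separable_bigcup (I : choiceType) (D : set I) (F : I -> set X) :
  countable D -> (forall i, D i -> separable (F i)) ->
  separable (\bigcup_(i in D) F i).
Proof.
move=> cD sF; have /choice[G GP] : forall i, exists C : set X, D i ->
    countable C /\
    forall a e, F i a -> 0 < e -> exists2 c, C c & mdist a c < e.
  move=> i; have [Di|nDi] := pselect (D i); last by exists set0.
  by have [C cC CF] := sF i Di; exists C.
exists (\bigcup_(i in D) G i).
  by apply: bigcup_countable => // i Di; have [] := GP i Di.
move=> a e [i Di Fia] e0; have [_ /(_ a e Fia e0)[c Gc ac]] := GP i Di.
by exists c => //; exists i.
Qed.

Lemma compact_totally_bounded A e : compact A -> 0 < e ->
  exists2 F : set X, finite_set F &
    forall a, A a -> exists2 c, F c & mdist a c < e.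
Proof.
move=> /compact_near_coveringP cA e0.
(* The filter of all sufficiently large sets of centres; compactness in its near-covering form,
   applied along it, yields one finite set for all of [A]. *)
pose FS := filter_from (@finite_set X) (fun F G => F `<=` G).
have FF : Filter FS.
  apply: filter_from_filter; first by exists set0.
  by move=> F G fF fG; exists (F `|` G) => [|H]; rewrite ?finite_setU// subUset.
have [] := cA _ FS (fun G a => exists2 c, G c & mdist a c < e) FF; last first.
  by move=> F fF FA; exists F => //; exact: FA.
move=> x _; exists (ball x e, [set G | G x]) => /=.
  split; first exact: nbhsx_ballx.
  by exists [set x] => // G; exact.
by move=> [y G] /= []; rewrite ballEmdist /= metric_sym; exists x.
Qed.

Lemma compact_separable A : compact A -> separable A.
Proof.
move=> cA; have /choice[F FP] : forall n : nat, exists F : set X,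
    finite_set F /\
    forall a, A a -> exists2 c, F c & mdist a c < n.+1%:R^-1.
  move=> n; have n0 : 0 < n.+1%:R^-1 :> R by rewrite invr_gt0.
  have [F fF FA] := compact_totally_bounded cA n0.
  by exists F.
exists (\bigcup_n F n).
  apply: bigcup_countable => // n _.
  by apply: finite_set_countable; have [] := FP n.
move=> a e Aa e0; have [n _ ne] := near_infty_natSinv_lt (PosNum e0).
have [_ /(_ a Aa)[c Fc ac]] := FP n; exists c; first by exists n.
by apply: lt_trans ac _; apply: ne => /=.
Qed.

End Separable.

(** * Normality in the separable case *)

Lemma normal_space_homeomorphic {R : realType} (S T : topologicalType) :
  homeomorphic S T -> normal_space T -> normal_space S.
Proof.
move=> [f [g [fK gK cf cg]]] /(@normal_openP R) nT.
apply/(@normal_openP R) => A B cA cB AB0.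
have [||//|U [V [oU oV AU BV UV0]]] := nT (g @^-1` A) (g @^-1` B).
- by apply: closed_comp => // t _; exact: cg.
- by apply: closed_comp => // t _; exact: cg.
- by rewrite -preimage_setI AB0 preimage_set0.
exists (f @^-1` U), (f @^-1` V); split.
- by apply: open_comp => // t _; exact: cf.
- by apply: open_comp => // t _; exact: cf.
- by move=> x Ax; apply: AU; rewrite /= fK.
- by move=> x Bx; apply: BV; rewrite /= fK.
- by rewrite -preimage_setI UV0 preimage_set0.
Qed.

Section Normal.
Local Open Scope ring_scope.
Context {R : realType} {X : metricType R}.

(** [dist_to] is 1-Lipschitz in the point, so the functionals at a countable dense set already
    generate the topology, and a countable supremum of pseudometric topologies is pseudometric. *)
Lemma separable_wijsman_normal :
  separable [set: X] -> normal_space (wijsman X).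
Proof.
move=> [C cC dC].
have cC' : countable [set: set_type C] by rewrite (eq_countable (card_setT C)).
pose dC_ (c : set_type C) (A : CL X) : R := dist_to (set_val c) (set_val A).
pose S : pseudoMetricType R := sup_pseudometric
  (fun c => PseudoMetric.class (@initial_topology (CL X) R (dC_ c))) cC'.
apply: (@normal_space_homeomorphic R _ S); last exact: pseudometric_normal.
exists id, id; split => //.
  move=> A; suff : nbhs (A : wijsman X) --> (A : S) by [].
  apply/cvg_sup => c.
  apply: (@continuous_comp_initial _ _ _ (dC_ c) (id : wijsman X -> _)).
  exact: wijsman_dist_to_continuous.
apply: (@continuous_to_wijsman R X S id) => x A.
pose F : set_system (CL X) := nbhs (A : S).
have FF : ProperFilter F by exact: (@nbhs_pfilter S A).
suff : (fun B : CL X => dist_to x (set_val B)) @ F -->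
  dist_to x (set_val A) by [].
apply/cvgrPdist_lt => e e0.
(* Passing from [x] to [c] costs less than [e / 3] at [A] and at [B]; the last third is the
   variation of the functional at [c]. *)
have [|c Cc xc] := dC x (e / 3) I; first by rewrite divr_gt0.
have dcA : dC_ (SigSub (mem_set Cc)) @ F --> dC_ (SigSub (mem_set Cc)) A.
  have cA : F --> (A : S) by exact: cvg_id.
  have /cvg_sup/(_ (SigSub (mem_set Cc))) {}cA := cA.
  apply: cvg_trans (@initial_continuous _ _ _ A) => //=; exact: cvg_app cA.
have /cvgrPdist_lt/(_ (e / 3)) := dcA.
rewrite divr_gt0// => /(_ isT); apply: filterS => B /=.
rewrite /dC_ /= !ltr_distlC => H.
have [A0 _] := set_valP A; have [B0 _] := set_valP B.
have := dist_to_triangle x c A0; have := dist_to_triangle c x A0.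
have := dist_to_triangle x c B0; have := dist_to_triangle c x B0.
by rewrite !(metric_sym c x); lra.
Qed.

End Normal.

(** * Eccentricity *)

Section Eccentricity.
Local Open Scope ring_scope.
Context {R : realType} {X : metricType R}.
Hypothesis niceX : nice_closed_balls X.
Hypothesis nsepX : ~ separable [set: X].
Implicit Types x y z : X.

(** [sup] has a default value on unbounded sets; [ecc_has_sup] shows that here it is a genuine
    supremum. *)
Definition ecc x : R := sup [set mdist x y | y in setT].

Lemma proper_ball_separable x r : mclosed_ball x r != setT ->
  separable (mclosed_ball x r).
Proof.
move=> ball_proper; have [r0|r0] := ltP 0 r.
  exact/compact_separable/niceX.
(* For [r <= 0], where niceness says nothing, the ball lies in [{x}]. *)
apply: (@separable_sub _ _ _ [set x]).
  move=> y /= xy; apply/esym/mdist_positivity/eqP.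
  by rewrite eq_le mdist_ge0 andbT (le_trans xy).
exact/separable_countable/finite_set_countable/finite_set1.
Qed.

Lemma bigcup_proper_ball x (r : nat -> R) (A : set X) :
  (forall n, mclosed_ball x (r n) != setT) ->
  (forall y, A y -> exists n, mdist x y <= r n) -> separable A.
Proof.
move=> rP Ar; apply: (@separable_sub _ _ _ (\bigcup_n mclosed_ball x (r n))).
  by move=> y /Ar[n xyr]; exists n.
apply: separable_bigcup => [|n _]; first exact: countableP.
exact: proper_ball_separable.
Qed.

(** Otherwise all balls of integer radius around [x] would be proper, and these countably many
    separable sets cover [X]. *)
Lemma ecc_has_sup x : has_sup [set mdist x y | y in setT].
Proof.
split; first by exists (mdist x x), x.
apply: contrapT => nub; apply: nsepX.
apply: (@bigcup_proper_ball x (fun n => n%:R)) => [n|y _]; last first.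
  by exists (Num.bound (mdist x y)); exact/ltW/archi_boundP/mdist_ge0.
apply/eqP => bT; apply: nub; exists n%:R => _ [y _ <-].
by have : mclosed_ball x n%:R y by rewrite bT.
Qed.

Lemma le_ecc x y : mdist x y <= ecc x.
Proof. apply: (sup_upper_bound (ecc_has_sup x)). by exists y. Qed.

Lemma lt_ecc_proper_ball x r : r < ecc x -> mclosed_ball x r != setT.
Proof.
move=> /(sup_gt (ecc_has_sup x).1) [_ [y _ <-] rxy].
apply/eqP => bT; have : mclosed_ball x r y by rewrite bT.
by rewrite /mclosed_ball /= leNgt rxy.
Qed.

(** The set is exhausted by the balls of radius [ecc x - 1/(n+1)], all of them proper. *)
Lemma lt_ecc_separable x : separable [set y | mdist x y < ecc x].
Proof.
apply: (@bigcup_proper_ball x (fun n => ecc x - n.+1%:R^-1)) => [n|y /= xy].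
  by apply: lt_ecc_proper_ball; rewrite ltrBlDr ltrDl invr_gt0.
have e0 : 0 < ecc x - mdist x y by rewrite subr_gt0.
have [n _ /(_ n (leqnn n))] := near_infty_natSinv_lt (PosNum e0).
by exists n => /=; rewrite lerBrDr -lerBrDl ltW.
Qed.

(** If no [z] worked, the countably many separable sets of points at distance less than [ecc c] from
    [c] would cover [X]. *)
Lemma exists_antipode (C : set X) : countable C ->
  exists z, forall c, C c -> mdist c z = ecc c.
Proof.
move=> cC; apply: contrapT => nz; apply: nsepX.
apply: (@separable_sub _ _ _ (\bigcup_(c in C) [set y | mdist c y < ecc c])).
  move=> y _; apply: contrapT => ny; apply: nz; exists y => c Cc.
  apply/eqP; rewrite eq_le le_ecc /= leNgt; apply/negP => cy.
  by apply: ny; exists c.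
by apply: separable_bigcup => // c _; exact: lt_ecc_separable.
Qed.

(** Take points [x n] whose eccentricities approach the supremum and a common antipode [z]: then
    [ecc (x n) = d(x n, z) <= ecc z]. *)
Lemma ecc_max : exists x, forall y, ecc y <= ecc x.
Proof.
(* The antipode of the empty family merely provides a point of [X]. *)
have [x0 _] := exists_antipode (countable0 X).
have Hs : has_sup (range ecc).
  split; first by exists (ecc x0), x0.
  exists (ecc x0 + ecc x0) => _ [y _ <-]; apply: ge_sup.
    exact: (ecc_has_sup y).1.
  move=> _ [z _ <-]; apply: le_trans (metric_triangle _ x0 _) _.
  by rewrite lerD ?le_ecc// metric_sym le_ecc.
have /choice[x xP] : forall n : nat, exists x,
    sup (range ecc) - n.+1%:R^-1 < ecc x.
  move=> n; have [|_ [x _ <-] supx] := sup_gt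
      (x := sup (range ecc) - n.+1%:R^-1) Hs.1; last by exists x.
  by rewrite ltrBlDr ltrDl invr_gt0.
have [|z zP] := @exists_antipode (range x).
  exact: sub_countable (card_image_le _ _) (countableP setT).
have xz n : ecc (x n) <= ecc z.
  by rewrite -zP; [rewrite metric_sym le_ecc|exists n].
exists z => y; apply: (@le_trans _ _ (sup (range ecc))).
  by apply: (sup_upper_bound Hs); exists y.
apply/ler_addgt0Pr => e e0.
have [n _ /(_ n (leqnn n)) /= ne] := near_infty_natSinv_lt (PosNum e0).
rewrite -lerBlDr; apply: le_trans (xz n); apply/ltW/(lt_trans _ (xP n)).
by rewrite ltrD2l ltrN2.
Qed.

Lemma ecc_gt0 x : 0 < ecc x.
Proof.
rewrite lt_neqAle (le_trans _ (le_ecc x x)) ?mdist_ge0// andbT.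
apply/negP => /eqP ecc0; apply: nsepX.
apply: (@separable_sub _ _ _ [set x]).
  move=> y _ /=; apply/esym/mdist_positivity/eqP.
  by rewrite eq_le mdist_ge0 andbT ecc0 le_ecc.
exact/separable_countable/finite_set_countable/finite_set1.
Qed.

(** A compact ball is covered by finitely many balls of radius [e / 2], and each of them contains
    [s i] for at most one index. *)
Lemma lt_ecc_finite (I : Type) (s : I -> X) x r e : 0 < e ->
  (forall i j, mdist (s i) (s j) < e -> i = j) ->
  r < ecc x -> finite_set [set i | mdist x (s i) <= r].
Proof.
move=> e0 s_sep rx.
(* The maximum makes the radius positive, as niceness requires, and keeps it below [ecc x]. *)
have cK : compact (mclosed_ball x (Num.max r (ecc x / 2))).
  have ecc0 := ecc_gt0 x.
  apply: niceX; first by rewrite lt_max divr_gt0// orbT.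
  by apply: lt_ecc_proper_ball; rewrite gt_max rx; lra.
have e20 : 0 < e / 2 by rewrite divr_gt0.
have [F fF FP] := compact_totally_bounded cK e20.
have /choice[c cP] : forall i, exists c, mdist x (s i) <= r ->
    F c /\ mdist (s i) c < e / 2.
  move=> i; have [xi|nxi] := pselect (mdist x (s i) <= r); last by exists x.
  have [|c Fc ic] := FP (s i); last by exists c.
  by rewrite /mclosed_ball /= le_max xi.
rewrite -(eq_finite_set (inj_card_eq _ : (c @` _ #= _)%card)).
  by apply: sub_finite_set fF => _ [i /= xi <-]; have [] := cP i xi.
move=> i j /set_mem /= xi /set_mem /= xj cij; apply: s_sep.
rewrite (le_lt_trans (metric_triangle _ (c i) _))// (splitr e) ltrD//.
  by have [] := cP i xi.
by rewrite metric_sym cij; have [] := cP j xj.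
Qed.

End Eccentricity.

(** * Transfinite choice *)

Lemma minimal_well_founded (I : Type) (prec : I -> I -> Prop) :
  (forall A : set I, A !=set0 ->
    exists2 m, A m & forall a, A a -> ~ prec a m) ->
  well_founded prec.
Proof.
move=> minP i; apply: contrapT => nAi.
have [|m nAm mP] := minP [set j | ~ Acc prec j]; first by exists i.
by apply: nAm; split => j jm; apply: contrapT => /mP.
Qed.

Lemma omega1_min (A : set omega1) : A !=set0 ->
  exists2 m, A m & forall a, A a -> (m <= a)%O.
Proof.
move=> [a Aa].
have [|m [[mA mlb] _]] := omega1_well_order (A := [pred t | `[< A t >]]).
  by exists a; apply/asboolP.
by exists m => [|b Ab]; [exact/asboolP|apply: mlb; exact/asboolP].
Qed.

Section TransfiniteChoice.
Context {I : choiceType} {T : Type}.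
Variables (r : I -> omega1) (G : set T) (Q : T -> T -> Prop).
Hypothesis r_countable : forall g, countable [set i | (r i <= g)%O].
Hypothesis extend : forall C : set T, countable C -> C `<=` G ->
  exists2 t, G t & forall c, C c -> Q c t.

Let tie : rel I := sval (well_ordering_principle I).

Let tie_chain : wo_chain tie predT.
Proof. by move=> A _; exact: svalP (well_ordering_principle I) A. Qed.

(** Rank first, then an arbitrary well-order: the predecessors of [i] have rank at most [r i], so
    they are countably many. *)
Let prec (i j : I) := (r i < r j)%O \/ [/\ r i = r j, i <> j & tie i j].

Let prec_le i j : prec i j -> (r i <= r j)%O.
Proof. by move=> [/ltW//|[-> _ _]]. Qed.

Let prec_total i j : i <> j -> prec i j \/ prec j i.
Proof.
move=> ij; have [rij|rij|rij] := ltgtP (r i) (r j).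
- by left; left.
- by right; left.
have /orP[tij|tji] : tie i j || tie j i by exact: (wo_chainW tie_chain).
  by left; right.
by right; right; split => // ji; apply: ij.
Qed.

Let prec_wf : well_founded prec.
Proof.
apply: minimal_well_founded => A [a Aa].
have [|_ [b Ab <-] bmin] := @omega1_min (r @` A); first by exists (r a), a.
have [|m [[/andP[/asboolP Am /eqP rm] mlb] _]] :=
  svalP (well_ordering_principle I) [pred i | `[< A i >] && (r i == r b)].
  by exists b; rewrite inE /= eqxx andbT; apply/asboolP.
exists m => // i Ai [|[rim im tim]].
  by rewrite rm ltNge bmin//; exists i.
have tmi : tie m i.
  by apply: mlb; rewrite inE /= rim rm eqxx andbT; apply/asboolP.
apply: im; apply: (wo_chain_antisymmetric tie_chain) => //.
by rewrite tim.
Qed.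

(** Well-founded recursion along [prec]: each value is chosen related to the countable set of
    earlier values. The conclusion is a disjunction because either index may come first. *)
Lemma transfinite_choice : exists s : I -> T,
  (forall i, G (s i)) /\ forall i j, i <> j -> Q (s i) (s j) \/ Q (s j) (s i).
Proof.
have /choice[nxt nxtP] : forall C : set T, exists t, countable C -> C `<=` G ->
    G t /\ forall c, C c -> Q c t.
  move=> C; have [[cC CG]|nC] := pselect (countable C /\ C `<=` G).
    by have [t Gt tP] := extend cC CG; exists t.
  (* Default for inadmissible [C]: some element of [T], obtained by extending the empty set. *)
  have [t _ _] := extend (countable0 T) (@sub0set _ G).
  by exists t => cC CG; case: nC.
pose step i (f : forall j, prec j i -> T) :=
  nxt [set t | exists j (ji : prec j i), f j ji = t].
pose s := Fix prec_wf (fun=> T) step.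
have sE i : s i = nxt [set s j | j in [set j | prec j i]].
  rewrite /s Fix_eq => [|j f g fg]; last first.
    congr nxt; apply/seteqP; split => t [k [kj <-]]; exists k, kj; rewrite fg//.
  congr nxt; apply/seteqP; split => t; first by move=> [j [ji <-]]; exists j.
  by move=> [j ji <-]; exists j, ji.
have cprec i : countable [set s j | j in [set j | prec j i]].
  apply: sub_countable (card_image_le _ _) _.
  apply: sub_countable (r_countable (r i)).
  by apply: subset_card_le => j /prec_le.
(* This needs induction: [nxt] is guaranteed to stay in [G] only if all earlier values do. *)
have sG i : G (s i).
  elim/(well_founded_ind prec_wf) : i => i IH; rewrite sE.
  have [|Gs _] := nxtP _ (cprec i); last exact: Gs.
  by move=> _ [j ji <-]; exact: IH.
have sQ i j : prec j i -> Q (s j) (s i).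
  move=> ji; rewrite (sE i).
  have [|_ Qs] := nxtP _ (cprec i); first by move=> _ [k _ <-]; exact: sG.
  by apply: Qs; exists j.
exists s; split => // i j /prec_total[/sQ|/sQ]; [by left|by right].
Qed.

End TransfiniteChoice.

(** * Countable initial segments of the index set *)

Lemma omega1_countable_le (g : omega1) : countable [set a | (a <= g)%O].
Proof.
have -> : [set a : omega1 | (a <= g)%O] = [set a | (a < g)%O] `|` [set g].
  apply/seteqP; split => a /=.
    by rewrite le_eqVlt => /orP[/eqP|]; [right|left].
  by move=> [/ltW|->].
rewrite -bigcup2E; apply: bigcup_countable => // -[_|[_|n _]] //=.
exact: omega1_countable_lt.
Qed.

(** The top [None] gets no weight: it adds one point per first coordinate, so sublevel sets stay
    countable. *)
Definition omega1_rank (p : omega1 * osucc omega1) : omega1 :=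
  if p.2 is Some b then Order.max p.1 b else p.1.

Lemma omega1_rank_countable g : countable [set p | (omega1_rank p <= g)%O].
Proof.
apply: (@sub_countable _ _ _ ([set a | (a <= g)%O] `*`
  (Some @` [set a | (a <= g)%O] `|` [set None]))); last first.
  apply: countableX; first exact: omega1_countable_le.
  rewrite -bigcup2E.
  apply: bigcup_countable => // -[_|[_|n _]] //=.
  exact: sub_countable (card_image_le _ _) (omega1_countable_le g).
apply: subset_card_le => -[a [b|]]; rewrite /omega1_rank /=; last first.
  by split; [|right].
by rewrite ge_max => /andP[ag bg]; split => //; left; exists b.
Qed.

(** * The embedding *)

Lemma order_cvg d (T : orderTopologicalType d) (F : set_system T) (x : T) :
  Filter F -> (forall a, (a < x)%O -> F [set y | (a < y)%O]) ->
  (forall a, (x < a)%O -> F [set y | (y < a)%O]) -> F --> x.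
Proof.
move=> FF Fgt Flt U; rewrite itv_nbhsE.
move=> [][][[]l|[]] [[]r|[]][]//= _; rewrite in_itv /= => xlr /filterS; apply.
- move/andP: xlr => [/Fgt lx /Flt xr]; apply: filterS2 lx xr => y /= ly yr.
  by rewrite in_itv /= ly.
- move: xlr; rewrite andbT => /Fgt; apply: filterS => y /=.
  by rewrite in_itv /= andbT.
- by move: xlr => /Flt; apply: filterS => y /=; rewrite in_itv.
- by apply: filterE => y.
Qed.

(** Some element lies above [a], since otherwise [omega1] would be countable; the least such element
    is the successor. Hence the closed ray up to [a] is also an open ray. *)
Lemma omega1_succ (a : omega1) :
  exists s, forall b : omega1, (b < s)%O = (b <= a)%O.
Proof.
have [|s /= sa smin] := @omega1_min [set s | (a < s)%O].
  apply: contrapT => na; apply: omega1_uncountable.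
  apply: sub_countable (omega1_countable_le a); apply: subset_card_le => b _ /=.
  by rewrite leNgt; apply/negP => ab; apply: na; exists b.
exists s => b; apply/idP/idP => [bs|/le_lt_trans]; last exact.
by rewrite leNgt; apply/negP => /smin; rewrite leNgt bs.
Qed.

(** * The product topology through the product order *)

Local Notation W1 := (order_topology omega1).
Local Notation W2 := (order_topology (osucc omega1)).
Local Notation W12 := (W1 * W2)%type.

Definition le12 (p q : W12) := (p.1 <= q.1)%O && (p.2 <= q.2)%O.

Lemma le12_refl p : le12 p p.
Proof. by rewrite /le12 !lexx. Qed.

Lemma le12_trans p q r : le12 p q -> le12 q r -> le12 p r.
Proof.
move=> /andP[pq1 pq2] /andP[qr1 qr2].
by rewrite /le12 (le_trans pq1) ?(le_trans pq2).
Qed.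

Lemma le12_anti p q : le12 p q -> le12 q p -> p = q.
Proof.
move: p q => [p1 p2] [q1 q2] /andP[/= pq1 pq2] /andP[/= qp1 qp2].
by congr (_, _); apply/le_anti; rewrite ?pq1 ?pq2.
Qed.

Lemma W1_open_le (a : W1) : open [set b : W1 | (b <= a)%O].
Proof.
have [s sP] := omega1_succ a; have := @lray_open _ W1 s; congr open.
by apply/seteqP; split => b /=; rewrite in_itv /= sP.
Qed.

Lemma W2_open_le (a : W2) : open [set b : W2 | (b <= a)%O].
Proof.
case: a => [a|]; last first.
  by rewrite (_ : mkset _ = setT); [exact: openT|apply/seteqP; split => -[]].
have [s sP] := omega1_succ a.
have sP' (b : W2) : (b < Some s)%O = (b <= Some a)%O.
  case: b => [b|] //; rewrite ltNge.
  have -> : (Some s <= Some b :> W2)%O = (s <= b)%O by [].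
  by rewrite -ltNge sP.
have := @lray_open _ W2 (Some s); congr open.
by apply/seteqP; split => b /=; rewrite in_itv /= sP'.
Qed.

Lemma le12_clopen (i : W12) : clopen [set p | le12 p i].
Proof.
have -> : [set p | le12 p i] =
    fst @^-1` [set a : W1 | (a <= i.1)%O] `&`
    snd @^-1` [set a : W2 | (a <= i.2)%O].
  by apply/seteqP; split => p /=; [move=> /andP[]|move=> [? ?]; apply/andP].
split.
  apply: openI.
    by apply: open_comp (W1_open_le _) => p _; exact: cvg_fst.
  by apply: open_comp (W2_open_le _) => p _; exact: cvg_snd.
apply: closedI.
  apply: (@closed_comp _ _ (fst : W12 -> W1)).
    by move=> p _; exact: cvg_fst.
  exact: (@lray_closed _ W1 i.1).
apply: (@closed_comp _ _ (snd : W12 -> W2)).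
  by move=> p _; exact: cvg_snd.
exact: (@lray_closed _ W2 i.2).
Qed.

Lemma near_le12 (p i : W12) : \forall q \near p, le12 q i = le12 p i.
Proof.
have [oD /closed_openC oC] := le12_clopen i.
have [pi|/negP pi] := boolP (le12 p i).
  by apply: filterS (open_nbhs_nbhs (conj oD pi)).
by apply: filterS (open_nbhs_nbhs (conj oC pi)) => q /negP/negPf.
Qed.

(** The clopen sets of [near_le12], [{q | q <= i}] and their complements, form a subbase, so
    convergence can be tested on them. *)
Lemma cvg_W12 (F : set_system W12) (p : W12) : Filter F ->
  (forall i, \forall q \near F, le12 q i = le12 p i) -> F --> p.
Proof.
move=> FF Fp; have Fple : F [set q | le12 q p].
  by apply: filterS (Fp p) => q; rewrite le12_refl.
case: p Fp Fple => p1 p2 Fp Fple.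
have F1 : fst @ F --> (p1 : W1).
  apply: order_cvg => a /= pa.
    (* [None] is the top, so this index constrains the first coordinate only. *)
    apply: filterS (Fp (a, None)) => q; rewrite /le12 /= [in RHS]leNgt pa /=.
    by rewrite ltNge; case: (q.1 <= a)%O => //=; case: q.2.
  by apply: filterS Fple => q /andP[/le_lt_trans qp _]; exact: qp.
have F2 : snd @ F --> (p2 : W2).
  apply: order_cvg => a /= pa.
    (* [omega1] has no top, but [p1] serves, since eventually [q.1 <= p1]. *)
    apply: filterS2 Fple (Fp (p1, a)) => q /andP[/= qp _].
    by rewrite /le12 /= qp lexx /= [in RHS]leNgt pa /= ltNge => ->.
  by apply: filterS Fple => q /andP[_ /le_lt_trans qp]; exact: qp.
move=> A Ap; have FA : F [set q | A (q.1, q.2)] by exact: (cvg_pair F1 F2 Ap).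
by suff : F A by []; apply: filterS FA => -[q1 q2].
Qed.

(** * Cones over an equilateral family *)

Section Embedding.
Local Open Scope ring_scope.
Context {R : realType} {X : metricType R}.
(** [E] abstracts the eccentricity and [rho] its maximal value. *)
Variables (E : X -> R) (rho : R) (s : W12 -> X).
Hypothesis rho_gt0 : 0 < rho.
Hypothesis mdist_s : forall i j, i <> j -> mdist (s i) (s j) = rho.
Hypothesis le_E : forall x y, mdist x y <= E x.
Hypothesis lt_E_finite : forall x r, r < E x ->
  finite_set [set i | mdist x (s i) <= r].

Lemma mdist_s_lt_eq i j : mdist (s i) (s j) < rho -> i = j.
Proof.
by move=> ij; apply: contrapT => /mdist_s ijE; move: ij; rewrite ijE ltxx.
Qed.

(** Two values of [s] within [rho / 2] of [y] have the same index, so all good approximations of [y]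
    are one and the same point. *)
Lemma adherent_image (J : set W12) y :
  (forall e, 0 < e -> exists2 i, J i & mdist y (s i) < e) ->
  exists2 i, J i & s i = y.
Proof.
move=> yJ; have rho2 : 0 < rho / 2 by rewrite divr_gt0.
have [i Ji yi] := yJ _ rho2; exists i => //; apply/esym/mdist_positivity/eqP.
rewrite eq_le mdist_ge0 andbT; apply/ler_addgt0Pr => e e0; rewrite add0r.
have [|j Jj] := yJ (Num.min e (rho / 2)); first by rewrite lt_min e0.
rewrite lt_min => /andP[yje yj]; suff -> : i = j by exact: ltW.
apply: mdist_s_lt_eq; rewrite (le_lt_trans (metric_triangle _ y _))// (splitr rho).
by rewrite ltrD// metric_sym.
Qed.

Lemma image_closed J : closed (s @` J).
Proof.
move=> y yJ; have [e e0|i Ji <-] := @adherent_image J y; last by exists i.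
have [_ [[i Ji <-]]] := yJ _ (nbhsx_ballx y e e0).
by rewrite ballEmdist; exists i.
Qed.

Lemma cone_CL p : CL X (s @` [set q | le12 p q]).
Proof.
split; last exact: image_closed.
by exists (s p), p => //; exact: le12_refl.
Qed.

Definition cone (p : W12) : wijsman X := SigSub (mem_set (cone_CL p)).

Lemma cone_mem i p : set_val (cone p) (s i) <-> le12 p i.
Proof.
split=> [[j pj sij]|pi]; last by exists i.
by rewrite -(@mdist_s_lt_eq j i)// sij mdistxx.
Qed.

Lemma cone_inj : injective cone.
Proof.
move=> p q pq; apply: le12_anti; apply/cone_mem.
  by rewrite pq; apply/cone_mem; exact: le12_refl.
by rewrite -pq; apply/cone_mem; exact: le12_refl.
Qed.

(** No distance from [x] exceeds [E x], so a point farther than [E x - e] can be replaced by any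
    point of the other image at a cost of at most [e]. *)
Lemma dist_to_image_le x (A B : set W12) e : 0 <= e -> A !=set0 -> B !=set0 ->
  (forall i, A i -> mdist x (s i) <= E x - e -> B i) ->
  dist_to x (s @` B) <= dist_to x (s @` A) + e.
Proof.
move=> e0 [a Aa] [b Bb] AB; rewrite -lerBlDr; apply: le_dist_to.
  by exists (s a), a.
move=> _ [i Ai <-]; rewrite lerBlDr.
have [xi|xi] := leP (mdist x (s i)) (E x - e).
  rewrite (@le_trans _ _ (mdist x (s i))) ?lerDl//.
  by apply: dist_to_le; exists i => //; exact: AB.
rewrite (@le_trans _ _ (mdist x (s b)))//; first by apply: dist_to_le; exists b.
by rewrite (le_trans (le_E _ _))// -lerBlDr ltW.
Qed.

(** Up to [e / 2], the distance depends only on the finitely many indices in [D], and near [p] the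
    relation to each of them is constant. *)
Lemma cone_continuous : continuous cone.
Proof.
apply: continuous_to_wijsman => x p; apply/cvgrPdist_lt => e e0.
have e20 : 0 < e / 2 by rewrite divr_gt0.
have /finite_fsetP[D DE] : finite_set [set i | mdist x (s i) <= E x - e / 2].
  by apply: lt_E_finite; rewrite ltrBlDr ltrDl.
have : nbhs p (\bigcap_(i in [set` D]) [set q | le12 q i = le12 p i]).
  by apply: filter_bigI => i _; exact: near_le12.
apply: filterS => q Dq; rewrite set_valE /=.
have pq i : mdist x (s i) <= E x - e / 2 -> le12 q i = le12 p i.
  by move=> xi; apply: Dq; rewrite -DE.
have near_dist p' q' : (forall i, mdist x (s i) <= E x - e / 2 ->
    le12 q' i = le12 p' i) ->
    dist_to x (s @` [set i | le12 q' i]) <=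
    dist_to x (s @` [set i | le12 p' i]) + e / 2.
  move=> pq'; apply: dist_to_image_le; first exact: ltW.
  - by exists p'; exact: le12_refl.
  - by exists q'; exact: le12_refl.
  - by move=> i /= pi /pq' ->.
have := near_dist p q pq; have := near_dist q p (fun i xi => esym (pq i xi)).
by rewrite ltr_distlC; lra.
Qed.

Lemma open_dist_to_lt x r :
  open [set A : wijsman X | dist_to x (set_val A) < r].
Proof.
apply: (@open_comp _ _
  (fun A : wijsman X => dist_to x (set_val A)) [set y | y < r]).
  by move=> A _; exact: wijsman_dist_to_continuous.
exact: open_lt.
Qed.

Lemma open_dist_to_gt x r :
  open [set A : wijsman X | r < dist_to x (set_val A)].
Proof.
apply: (@open_comp _ _
  (fun A : wijsman X => dist_to x (set_val A)) [set y | r < y]).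
  by move=> A _; exact: wijsman_dist_to_continuous.
exact: open_gt.
Qed.

Lemma cone_dist_lt i p : dist_to (s i) (set_val (cone p)) < rho -> le12 p i.
Proof.
have [cp0 _] := set_valP (cone p).
by move=> /(dist_to_lt cp0)[_ [j pj <-] /mdist_s_lt_eq ->].
Qed.

Lemma cone_dist_gt0 i p : 0 < dist_to (s i) (set_val (cone p)) -> ~ le12 p i.
Proof. by move=> + /cone_mem pi; rewrite dist_to_mem ?ltxx. Qed.

(** The distance from [s i] to a cone is zero or at least [rho], so a strict bound on it decides
    membership; [B] itself is an arbitrary closed set. *)
Lemma near_cone_mem (B : wijsman X) i :
  exists U : set (wijsman X), nbhs B U /\
    forall p, U (cone p) -> (le12 p i <-> set_val B (s i)).
Proof.
have [B0 cB] := set_valP B.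
have [Bi|nBi] := pselect (set_val B (s i)).
  exists [set A | dist_to (s i) (set_val A) < rho]; split.
    apply: open_nbhs_nbhs; split; first exact: open_dist_to_lt.
    by rewrite /= dist_to_mem.
  by move=> p /cone_dist_lt.
exists [set A | 0 < dist_to (s i) (set_val A)]; split.
  by apply: open_nbhs_nbhs; split; [exact: open_dist_to_gt|exact: dist_to_gt0].
by move=> p /cone_dist_gt0.
Qed.

Lemma cone_range_closed : closed (range cone).
Proof.
move=> B Bcl; have [B0 cB] := set_valP B.
pose J : set W12 := [set i | set_val B (s i)].
have JB : s @` J = set_val B.
  apply/seteqP; split => [_ [i Ji <-]//|y By].
  (* Cones close to [B] meet every ball around [y], so values of [s] approximate [y]. *)
  have [e e0|i _ siy] := @adherent_image setT y; last first.
    by exists i => //; rewrite /J /= siy.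
  have [|_ [[p _ <-] /= ype]] := Bcl [set A | dist_to y (set_val A) < e].
    apply: open_nbhs_nbhs; split; first exact: open_dist_to_lt.
    by rewrite /= dist_to_mem.
  have [cp0 _] := set_valP (cone p).
  by have [_ [i _ <-] yi] := dist_to_lt cp0 ype; exists i.
(* Three indices suffice: two realise the minimal coordinates, the third is tested. *)
have Jcone i j k : exists p,
    [/\ le12 p i <-> J i, le12 p j <-> J j & le12 p k <-> J k].
  have [U [BU UP]] := near_cone_mem B i.
  have [V [BV VP]] := near_cone_mem B j.
  have [W [BW WP]] := near_cone_mem B k.
  have [_ [[p _ <-] [[Up Vp] Wp]]] := Bcl _ (filterI (filterI BU BV) BW).
  by exists p; split; [exact: UP|exact: VP|exact: WP].
have [i0 Ji0] : J !=set0.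
  by case: B0 => y By; have [i Ji _] : (s @` J) y by [rewrite JB]; exists i.
have [|_ [i Ji <-] imin] := @omega1_min (fst @` J); first by exists i0.1, i0.
(* If no second coordinate in [J] lies below the top, they are all [None] and any index in [J]
   serves. *)
have [j Jj jmin] : exists2 j, J j & forall k, J k -> (j.2 <= k.2)%O.
  pose J2 : set omega1 := [set b | exists2 k, J k & k.2 = Some b].
  have [[b [k Jk kb]]|nJ] := pselect (J2 !=set0).
    have [|b' [k' Jk' kb'] bmin] := @omega1_min J2.
      by exists b, k.
    exists k' => // l Jl; rewrite kb'; case lE : l.2 => [c|//].
    by apply: (bmin c); exists l.
  exists i0 => // l Jl; case lE : l.2 => [c|]; last by case: (i0.2).
  by exfalso; apply: nJ; exists c, l.
exists (i.1, j.2) => //; apply: val_inj; rewrite -[RHS]JB /=.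
congr (s @` _); apply/seteqP; split => k /= => [ijk|Jk]; last first.
  by apply/andP; split; [apply: imin; exists k|exact: jmin].
(* This [p] lies below [i] and [j], hence below [(i.1, j.2)] and below [k]; so [k] is in [J]. *)
have [p [[_ pi] [_ pj] [Jk _]]] := Jcone i j k.
apply: Jk; apply: le12_trans ijk.
by have /andP[pi1 _] := pi Ji; have /andP[_ pj2] := pj Jj; apply/andP.
Qed.

Lemma range_cone_homeomorphic : homeomorphic (set_type (range cone)) W12.
Proof.
pose g (c : range cone) : W12 := sval (cid2 (set_valP c)).
have gP c : cone (g c) = set_val c by rewrite /g; case: cid2.
pose f (p : W12) : range cone := SigSub (mem_set (imageT cone p)).
exists g, f; split.
- by move=> c; apply: val_inj; rewrite /= gP.
- by move=> p; apply: cone_inj; rewrite gP.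
(* The inverse is continuous because a neighbourhood of [c] decides how its values compare with each
   [i]. *)
- move=> c; have gF : Filter (g @ nbhs c) by exact: fmap_filter.
  apply: (cvg_W12 gF) => i.
  have [U [cU UP]] := near_cone_mem (set_val c) i.
  have : nbhs c (set_val @^-1` U).
    exact: (@initial_continuous _ _ set_val c _ cU).
  apply: filterS => c' /= Uc'; apply/idP/idP.
    by rewrite -gP in Uc'; move/(UP _ Uc'); rewrite -gP => /cone_mem.
  by rewrite -gP in Uc' => /cone_mem; rewrite gP => /(UP _ Uc').
- by apply: continuous_comp_initial; exact: cone_continuous.
Qed.

End Embedding.

(** * An equilateral family of maximal side and the closed copy *)

Theorem theorem3p1 (R : realType) (X : metricType R) :
  nice_closed_balls X ->
  ~ normal_space (wijsman X) ->
  exists C : set (wijsman X),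
    closed C /\
    homeomorphic (set_type C)
      (order_topology omega1 * order_topology (osucc omega1))%type.
Proof.
move=> niceX nnormal.
have nsepX : ~ separable [set: X] by move/separable_wijsman_normal.
have [x0 x0_max] := ecc_max niceX nsepX.
(* Staying among points of maximal eccentricity makes every antipodal distance equal to [ecc x0]. *)
have [|s [_ sQ]] := @transfinite_choice (omega1 * osucc omega1)%type X
    omega1_rank [set z | ecc z = ecc x0] (fun c z => mdist c z = ecc x0)
    omega1_rank_countable.
  (* Adding [x0] forces [ecc z >= d(x0, z) = ecc x0], so [z] again has maximal eccentricity. *)
  move=> C cC CG; have [|z zP] := @exists_antipode _ _ niceX nsepX (x0 |` C).
    rewrite -bigcup2E; apply: bigcup_countable => // -[_|[_|n _]] //=.
  exists z => /= [|c Cc]; last by rewrite zP ?CG//; right.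
  apply/le_anti; rewrite x0_max /= -[X in (X <= _)%R]zP; last by left.
  by rewrite metric_sym le_ecc.
have mdist_s i j : i <> j -> mdist (s i) (s j) = ecc x0.
  by move=> /sQ[//|]; rewrite metric_sym.
have rho_gt0 := ecc_gt0 niceX nsepX x0.
have le_ecc' := le_ecc niceX nsepX.
have finite_s x r : (r < ecc x)%R ->
    finite_set [set i | (mdist x (s i) <= r)%R].
  apply: (lt_ecc_finite niceX nsepX rho_gt0) => i j.
  exact: mdist_s_lt_eq mdist_s i j.
exists (range (cone rho_gt0 mdist_s)); split.
  exact: cone_range_closed.
exact: (range_cone_homeomorphic rho_gt0 mdist_s le_ecc' finite_s).
Qed.
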